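(* Let $Z$ be a real or complex normed space that is strongly facially symmetric, and let $\tilde Z$ be its completion. For $u\in Z^*$ let $\widetilde u\in\tilde Z^*$ denote its unique norm-preserving extension. Assume that $Z$ satisfies the following face-density condition: for every $u\in Z^*$ with $\|u\|=1$ such that $F^{\tilde Z}_{\widetilde u}=\{z\in\tilde Z:\|z\|\le 1,\ \widetilde u(z)=1\}$ is nonempty, the set $F^Z_u=\{x\in Z:\|x\|\le 1,\ u(x)=1\}$ is nonempty and its norm closure in $\tilde Z$ equals $F^{\tilde Z}_{\widetilde u}$. Then $\tilde Z$ is strongly facially symmetric.
   Context: Let $X$ be a real or complex normed space with closed unit ball $X_1$ and dual $X^*$. Orthogonality: $f,g\in X$ are orthogonal, $f\diamond g$, if $\|f+g\|=\|f-g\|=\|f\|+\|g\|$. For $S\subset X$, $S^\diamond=\{f\in X: f\diamond g \text{ for every } g\in S\}$. A norm-exposed face of $X_1$ is a nonempty set of the form $F_u=\{f\in X_1: u(f)=1\}$ with $u\in X^*$, $\|u\|=1$. A norm-exposed face $F$ is symmetric if there is a surjective linear isometry $S_F:X\to X$ with $S_F^2=I$ and $\operatorname{Fix}(S_F)=\{x: S_Fx=x\}=\overline{\operatorname{sp}(F)}\oplus F^\diamond$, where $\overline{\operatorname{sp}(F)}$ is the norm-closed linear span of $F$ in $X$. Such $S_F$ is called a symmetry corresponding to $F$. $X$ is weakly facially symmetric (WFS) if every norm-exposed face of $X_1$ is symmetric. A WFS space $X$ is strongly facially symmetric (SFS) if for every symmetric face $F_u\subset X_1$ and every $v\in X^*$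 with $\|v\|=1$ and $F_u\subset F_v$, one has $S_u^*v=v$, i.e. $v\circ S_u=v$, where $S_u$ is a symmetry corresponding to $F_u$. *)

(* Defs.v *)
From HB Require Import structures.
From mathcomp Require Import all_boot all_order all_algebra.
From mathcomp Require Import complex.
From mathcomp Require Import all_classical all_reals all_analysis.

Set Implicit Arguments.
Unset Strict Implicit.
Unset Printing Implicit Defensive.

Import Order.TTheory GRing.Theory Num.Theory.
Import numFieldNormedType.Exports.

Local Open Scope classical_set_scope.
Local Open Scope ring_scope.

(* The complex numbers if [c] is true, the real numbers otherwise. *)
Definition scalar_field (R : realType) (c : bool) : numFieldType :=
  if c then R[i]%C : numFieldType else R : numFieldType.

Section Facial.
Context {K : numFieldType} {X : normedModType K}.
Implicit Types (u v : {linear X -> K^o}) (F A B C : set X) (f g : X).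

(* Elements of X^* are the [u : {linear X -> K^o}] with [continuous u].
   The supremum is taken in K: as the order of R[i] relates only numbers with
   the same imaginary part, the supremum of a bounded nonempty set of
   (nonnegative real) norms in R[i] is its usual real supremum. *)
Definition dual_norm u : K := supremum 0 [set `|u f| | f in [set f | `|f| <= 1]].

Definition unit_functional u : Prop := continuous u /\ dual_norm u = 1.

Definition orthogonal f g : Prop :=
  `|f + g| = `|f| + `|g| /\ `|f - g| = `|f| + `|g|.

Definition ortho_compl F : set X := [set f | forall g, F g -> orthogonal f g].

Definition face u : set X := [set f | `|f| <= 1 /\ u f = 1].

Definition norm_exposed_face F : Prop :=
  F !=set0 /\ exists2 u, unit_functional u & F = face u.

Definition is_subspace A : Prop := submod_closed (mem A).

Definition closed_span F : set X := closure (smallest is_subspace F).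

(* C is the internal direct sum of the linear subspaces A and B.  An orthogonal
   complement F^<> is not a subspace by definition: that it is one is part of
   what a decomposition [closed_span F (+) F^<>] asserts. *)
Definition is_direct_sum A B C : Prop :=
  [/\ is_subspace A, is_subspace B, A `&` B = [set 0]
    & C = [set f + g | f in A & g in B]].

Definition fixed_points (S : X -> X) : set X := [set f | S f = f].

Definition is_symmetry F (S : {linear X -> X}) : Prop :=
  [/\ set_surj setT setT S,
      forall f, `|S f| = `|f|,
      forall f, S (S f) = f
    & is_direct_sum (closed_span F) (ortho_compl F) (fixed_points S)].

Definition symmetric_face F : Prop :=
  norm_exposed_face F /\ exists S : {linear X -> X}, is_symmetry F S.

End Facial.

Definition WFS (K : numFieldType) (X : normedModType K) : Prop :=
  forall F : set X, norm_exposed_face F -> symmetric_face F.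

(* A norm-exposed face has at most one symmetry (two involutive isometries with
   the same fixed points coincide), so quantifying over all of them is the same
   as choosing one. *)
Definition SFS (K : numFieldType) (X : normedModType K) : Prop :=
  WFS X /\
  forall u v : {linear X -> K^o},
    unit_functional u -> symmetric_face (face u) ->
    unit_functional v -> face u `<=` face v ->
    forall S : {linear X -> X}, is_symmetry (face u) S ->
      forall f, v (S f) = v f.

Section Completion.
Context {K : numFieldType} {Z : normedModType K} {Zt : completeNormedModType K}.
Variable iota : {linear Z -> Zt}.

(* A completion of Z is a complete space with a linear isometric embedding of Z
   onto a dense subspace; it is unique up to isometric isomorphism. *)
Definition is_completion : Prop :=
  (forall z, `|iota z| = `|z|) /\ dense (range iota).

(* [ut], in the dual of the completion, is the norm-preserving extension
   of [u]. *)
Definition norm_extension (u : {linear Z -> K^o}) (ut : {linear Zt -> K^o}) : Prop :=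
  [/\ continuous ut, forall z, ut (iota z) = u z & dual_norm ut = dual_norm u].

Definition face_density : Prop :=
  forall (u : {linear Z -> K^o}) (ut : {linear Zt -> K^o}),
    unit_functional u -> norm_extension u ut -> face ut !=set0 ->
    face u !=set0 /\ closure (iota @` face u) = face ut.

End Completion.

(* Main.v *)
Require Import Defs.
From HB Require Import structures.
From mathcomp Require Import all_boot all_order all_algebra.
From mathcomp Require Import ring.
From mathcomp Require Import complex.
From mathcomp Require Import all_classical all_reals all_analysis.

(* Let [F~] be a norm-exposed face of the completion, [F] its trace on [Z] and
   [S] the symmetry of [F], which extends isometrically to the completion.  For
   [b] in [F~^<>], Hahn-Banach gives contractive functionals [w], [w'] equal to
   1 on [F~] with [w b = |b|] and [w' b = - |b|].  Their half difference [v]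
   vanishes on [F~], and the unit vectors exposed by [v] all lie in [F~^<>].
   Hence:
   - in [Z], [|b| <= |a + b|] for [a] in the closed span of [F] and [b] in
     [F^<>], so the decomposition of the fixed points of [S] passes to the
     completion although [Z] is not complete;
   - face density, applied to the face exposed by [v], shows that [F~^<>] is the
     closure of [F^<>], hence a subspace fixed by the extension of [S].
   That a symmetry leaves invariant every functional exposing a larger face
   passes from [Z] to its completion by density, symmetries being unique. *)

Set Implicit Arguments.
Unset Strict Implicit.
Unset Printing Implicit Defensive.

Import Order.TTheory GRing.Theory Num.Theory.
Import numFieldNormedType.Exports.

Local Open Scope classical_set_scope.
Local Open Scope ring_scope.

(** * Sublinear functionals and the real Hahn-Banach theorem *)

Section Sublinear.
Context {R : realType} {K : numFieldType} {V : lmodType K}.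
(** Real scalars act on [V] through [e], so that one real argument serves both [K = R] and [K =
    R[i]]. *)
Variable e : {rmorphism R -> K}.
Implicit Types (p q : V -> R) (G : V -> set R).

Definition sublinear p : Prop :=
  (forall x y, p (x + y) <= p x + p y) /\
  (forall r x, 0 <= r -> p (e r *: x) <= r * p x).

Lemma sublinear0 p : sublinear p -> p 0 = 0.
Proof.
move=> [pD pZ]; apply/eqP; rewrite eq_le; apply/andP; split.
  by have := pZ 0 0 (lexx _); rewrite scaler0 mul0r.
by have := pD 0 0; rewrite addr0 lerDl.
Qed.

Lemma sublinear_geN p x : sublinear p -> - p (- x) <= p x.
Proof.
move=> ps; have := ps.1 x (- x).
by rewrite subrr (sublinear0 ps) -lerBlDr sub0r.
Qed.

(** Common to the three infima used below: over a chain of functionals, along a ray, and over a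
    cone. *)
Lemma sublinear_inf G :
  (forall x, G x !=set0) -> (forall x, has_lbound (G x)) ->
  (forall x y a b, G x a -> G y b -> exists2 c, G (x + y) c & c <= a + b) ->
  (forall r x a, 0 <= r -> G x a -> exists2 c, G (e r *: x) c & c <= r * a) ->
  sublinear (fun x => inf (G x)).
Proof.
move=> G0 Gb GD GZ; split=> [x y|r x r0].
  rewrite -lerBlDr; apply: lb_le_inf => // a Ga.
  rewrite lerBlDl -lerBlDr; apply: lb_le_inf => // b Gb'.
  rewrite lerBlDl; have [c Gc cab] := GD _ _ _ _ Ga Gb'.
  by apply: (le_trans _ cab); apply: ge_inf.
have infZ a : G x a -> inf (G (e r *: x)) <= r * a.
  move=> Ga; have [c Gc ca] := GZ _ _ _ r0 Ga.
  by apply: (le_trans _ ca); apply: ge_inf.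
move: r0; rewrite le_eqVlt => /predU1P[r0|r0].
  by have [a /infZ] := G0 x; rewrite -r0 !mul0r.
rewrite -ler_pdivrMl//; apply: lb_le_inf => // a /infZ.
by rewrite ler_pdivrMl.
Qed.

(** Zorn's lemma applies because the pointwise infimum of a chain is again sublinear: [- p0 (- x)]
    bounds it below, and of two members of the chain the smaller one serves both summands in
    subadditivity. *)
Lemma sublinear_minimal p0 : sublinear p0 ->
  exists p, [/\ sublinear p, forall x, p x <= p0 x
    & forall q, sublinear q -> (forall x, q x <= p x) -> q =1 p].
Proof.
move=> p0s.
pose T := {p : V -> R | sublinear p /\ forall x, p x <= p0 x}.
(* The order is reversed, as Zorn's lemma produces maximal elements. *)
pose ge (s t : T) : bool := `[< forall x, sval t x <= sval s x >].
have [t|r s t /asboolP rs /asboolP st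
    |[s ps] [t pt] /asboolP st /asboolP ts|A Atot|] := @Zorn T ge.
- by apply/asboolP.
- by apply/asboolP => x; apply: le_trans (st x) (rs x).
- apply: eq_exist; apply/funext => x; apply/eqP.
  by rewrite eq_le st ts.
- have [->|/set0P[s0 As0]] := eqVneq A set0.
    by exists (exist _ p0 (conj p0s (fun x => lexx _))).
  pose G x := [set sval s x | s in A].
  have Gb x : lbound (G x) (- p0 (- x)).
    move=> _ [s As <-]; have [ss sp0] := svalP s.
    by apply: (le_trans _ (sublinear_geN x ss)); rewrite lerN2.
  have Gs : sublinear (fun x => inf (G x)).
    apply: sublinear_inf.
    + by move=> x; exists (sval s0 x); exists s0.
    + by move=> x; exists (- p0 (- x)); exact: Gb.
    + move=> x y _ _ [s As <-] [t At <-].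
      have [/asboolP st|/asboolP ts] := Atot s t As At.
        exists (sval t (x + y)); first by exists t.
        apply: le_trans ((svalP t).1.1 x y) _.
        by rewrite lerD2r.
      exists (sval s (x + y)); first by exists s.
      apply: le_trans ((svalP s).1.1 x y) _.
      by rewrite lerD2l.
    + move=> r x _ r0 [s As <-]; exists (sval s (e r *: x)); first by exists s.
      exact: (svalP s).1.2.
  have Gle s x : A s -> inf (G x) <= sval s x.
    move=> As; apply: ge_inf; last by exists s.
    by exists (- p0 (- x)); exact: Gb.
  have Gp0 x : inf (G x) <= p0 x.
    by apply: le_trans (Gle s0 x As0) _; case: (svalP s0).
  exists (exist _ (fun x => inf (G x)) (conj Gs Gp0)) => s As.
  by apply/asboolP => x; exact: Gle.
- move=> [p [ps pp0]] pmin; exists p; split=> // q qs qp.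
  have qp0 x : q x <= p0 x by apply: le_trans (qp x) _.
  have := pmin (exist _ q (conj qs qp0)) (asboolT qp).
  by move=> /(congr1 sval)/= ->.
Qed.

(* A minimal sublinear functional [p] is odd: for each [y] it is equal to the
   sublinear functional [inf_(t >= 0) (p (x + t y) - t p y)], whose value at
   [- y] is at most [- p y]. *)
Lemma hahn_banach p0 : sublinear p0 ->
  exists w : V -> R, [/\ {morph w : x y / x + y},
    forall r x, w (e r *: x) = r * w x & forall x, w x <= p0 x].
Proof.
move=> /sublinear_minimal[p [ps pp0 pmin]].
have [pD pZ] := ps.
have pN y : p (- y) = - p y.
  pose G x := [set p (x + e t *: y) - t * p y | t in [set t | 0 <= t]].
  have Gb x : lbound (G x) (- p (- x)).
    move=> _ [t /= t0 <-]; rewrite lerBrDr addrC lerBlDr.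
    apply: (le_trans _ (pD _ _)); rewrite addrAC subrr add0r.
    have [->|tn0] := eqVneq t 0; first
      by rewrite rmorph0 scale0r mul0r sublinear0.
    have := pZ t^-1 (e t *: y); rewrite invr_ge0 => /(_ t0).
    rewrite scalerA -rmorphM mulVf// rmorph1 scale1r.
    by rewrite ler_pdivlMl// lt_def tn0.
  have Gle x t : 0 <= t -> inf (G x) <= p (x + e t *: y) - t * p y.
    move=> t0; apply: ge_inf; last by exists t.
    by exists (- p (- x)); exact: Gb.
  have Gs : sublinear (fun x => inf (G x)).
    apply: sublinear_inf.
    + by move=> x; exists (p (x + e 0 *: y) - 0 * p y); exists 0 => /=.
    + by move=> x; exists (- p (- x)); exact: Gb.
    + move=> x1 x2 _ _ [t /= t0 <-] [t' /= t'0 <-].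
      exists (p (x1 + x2 + e (t + t') *: y) - (t + t') * p y).
        by exists (t + t') => //=; rewrite addr_ge0.
      rewrite rmorphD scalerDl addrACA mulrDl opprD [leRHS]addrACA.
      by rewrite lerD2r pD.
    + move=> r x _ r0 [t /= t0 <-].
      exists (p (e r *: x + e (r * t) *: y) - (r * t) * p y).
        by exists (r * t) => //=; rewrite mulr_ge0.
      rewrite rmorphM -scalerA -scalerDr mulrBr mulrA lerD2r.
      exact: pZ.
  (* The term [t = 0] shows that the infimum lies below [p], so minimality makes the two equal. *)
  have GE := pmin _ Gs.
  have {}GE : forall x, inf (G x) = p x.
    apply: GE => x; apply: le_trans (Gle x 0 (lexx _)) _.
    by rewrite rmorph0 scale0r addr0 mul0r subr0.
  apply/eqP; rewrite eq_le; apply/andP; split; last first.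
    by have := sublinear_geN (- y) ps; rewrite opprK.
  rewrite -GE; apply: le_trans (Gle (- y) 1 ler01) _.
  by rewrite rmorph1 scale1r addNr sublinear0// sub0r mul1r.
have pZ' r x : 0 <= r -> p (e r *: x) = r * p x.
  move=> r0; apply/eqP; rewrite eq_le pZ//= -lerN2 -mulrN -!pN -scalerN.
  exact: pZ.
exists p; split=> // [x y|r x].
  apply/eqP; rewrite eq_le pD /= -lerN2 opprD -!pN opprD.
  exact: pD.
have [r0|r0] := leP 0 r; first exact: pZ'.
rewrite -[r]opprK rmorphN scaleNr pN pZ' ?mulNr// oppr_ge0.
exact: ltW.
Qed.

End Sublinear.

(** * Functionals norming a cone on which the norm is additive, over the reals and the complex
    numbers *)

Lemma cone_functional (R : realType) (K : numFieldType) (V : lmodType K)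
    (e : {rmorphism R -> K}) (N : V -> R) (C : set V) :
  (forall x y, N (x + y) <= N x + N y) ->
  (forall r x, N (e r *: x) = `|r| * N x) ->
  C 0 -> (forall x y, C x -> C y -> C (x + y)) ->
  (forall r x, 0 <= r -> C x -> C (e r *: x)) ->
  (forall x y, C x -> C y -> N (x + y) = N x + N y) ->
  exists w : V -> R, [/\ {morph w : x y / x + y},
    forall r x, w (e r *: x) = r * w x, forall x, w x <= N x
    & forall c, C c -> w c = N c].
Proof.
move=> ND NZ C0 CD CZ NC.
have NN x : N (- x) = N x.
  by have := NZ (-1) x; rewrite rmorphN rmorph1 scaleN1r normrN1 mul1r.
have N0 : N 0 = 0 by have := NZ 0 0; rewrite scaler0 normr0 mul0r.
(* The infimum lies below [N] (take [c = 0]) and is at most [- N c] at [- c], so a linear functional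
   below it satisfies [N c <= w c]. Additivity of [N] on [C] is what makes it subadditive. *)
pose G x := [set N (x + c) - N c | c in C].
have Gb x : lbound (G x) (- N x).
  move=> _ [c Cc <-]; rewrite lerBrDr addrC lerBlDr -[N x]NN.
  by apply: (le_trans _ (ND _ _)); rewrite addrAC subrr add0r.
have Gle x c : C c -> inf (G x) <= N (x + c) - N c.
  move=> Cc; apply: ge_inf; last by exists c.
  by exists (- N x); exact: Gb.
have Gs : sublinear e (fun x => inf (G x)).
  apply: sublinear_inf.
  - by move=> x; exists (N (x + 0) - N 0); exists 0.
  - by move=> x; exists (- N x); exact: Gb.
  - move=> x y _ _ [c Cc <-] [d Cd <-].
    exists (N (x + y + (c + d)) - N (c + d)); first by exists (c + d); auto.
    by rewrite (NC c d)// addrACA opprD [leRHS]addrACA lerD2r.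
  - move=> r x _ r0 [c Cc <-].
    exists (N (e r *: x + e r *: c) - N (e r *: c)).
      by exists (e r *: c); auto.
    by rewrite -scalerDr !NZ ger0_norm// mulrBr.
have [w [wD wZ wG]] := hahn_banach Gs.
have wN x : w x <= N x.
  by apply: le_trans (wG x) _; have := Gle x 0 C0; rewrite addr0 N0 subr0.
have wNN x : w (- x) = - w x.
  by have := wZ (-1) x; rewrite rmorphN rmorph1 scaleN1r mulN1r.
exists w; split=> // c Cc; apply/eqP; rewrite eq_le wN /= -lerN2 -wNN.
by apply: le_trans (wG (- c)) _; have := Gle (- c) c Cc; rewrite addNr N0 sub0r.
Qed.

(* The form of the Hahn-Banach theorem needed below; stating it as a property of
   [X] lets the rest of the argument treat real and complex scalars at once. *)
Definition norms_cones (K : numFieldType) (X : normedModType K) : Prop :=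
  forall C : set X, C 0 -> (forall x y, C x -> C y -> C (x + y)) ->
  (forall r x, 0 <= r -> C x -> C (r *: x)) ->
  (forall x y, C x -> C y -> `|x + y| = `|x| + `|y|) ->
  exists w : {linear X -> K^o},
    (forall x, `|w x| <= `|x|) /\ forall c, C c -> w c = `|c|.

Lemma norms_cones_real (R : realType) (X : normedModType R) : norms_cones X.
Proof.
move=> C C0 CD CZ NC.
have [||||||w [wD wZ wN wC]] := @cone_functional R R X idfun (fun x => `|x|) C.
- exact: ler_normD.
- exact: normrZ.
- by [].
- by [].
- exact: CZ.
- exact: NC.
have wlin : linear (w : X -> R^o) by move=> r x y; rewrite wD wZ.
pose L : {linear X -> R^o} := HB.pack w (GRing.isLinear.Build _ _ _ _ w wlin).
exists L; split=> // x; rewrite ler_norml wN andbT lerNl.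
rewrite -normrN; apply: le_trans (wN (- x)).
by have := wZ (-1) x; rewrite /= scaleN1r mulN1r => ->.
Qed.

(** The underlying real space provides a real functional [w]; [w x - i w (i x)] is the complex
    linear functional with real part [w]. *)
Lemma norms_cones_complex (R : realType) (X : normedModType R[i]) :
  norms_cones X.
Proof.
move=> C C0 CD CZ NC.
pose N (x : X) := complex.Re `|x|.
have NE x : (N x)%:C%C = `|x| by apply: RRe_real; exact: normr_real.
have [||||||w [wD wZ wN wC]] := @cone_functional R R[i] X (real_complex R) N C.
- by move=> x y; rewrite -lecR rmorphD /= !NE; exact: ler_normD.
- move=> r x; apply: (@complexI R); rewrite rmorphM /= !NE normrZ.
  by rewrite normc_def /= expr0n addr0 sqrtr_sqr.
- by [].
- by [].
- by move=> r x r0; apply: CZ; rewrite ler0c.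
- by move=> x y Cx Cy; apply: (@complexI R); rewrite rmorphD /= !NE NC.
have wB x y : w (x - y) = w x - w y.
  by rewrite wD -[- y]scaleN1r -[in LHS](rmorph1 (real_complex R)) -rmorphN
             wZ mulN1r.
pose phi x : R[i]^o := (w x +i* - w ('i%C *: x))%C.
have philin : linear phi.
  move=> k x y; rewrite /phi scalerDr !wD scalerA.
  have kE : k *: x =
      (complex.Re k)%:C%C *: x + (complex.Im k)%:C%C *: ('i%C *: x).
    by rewrite scalerA -scalerDl mulrC -complexE.
  have ikE : ('i%C * k) *: x =
      (complex.Re k)%:C%C *: ('i%C *: x) - (complex.Im k)%:C%C *: x.
    rewrite scalerA -scalerBl; congr (_ *: x).
    by rewrite [in LHS](complexE k); simpc.
  rewrite kE ikE wD wB !wZ; case: k {kE ikE} => a b /=.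
  apply/eqP; rewrite eq_complex /=; apply/andP; split; apply/eqP; ring.
pose L : {linear X -> R[i]^o} :=
  HB.pack phi (GRing.isLinear.Build _ _ _ _ phi philin).
have Lle x : `|L x| <= `|x|.
  have [->|Lx0] := eqVneq (L x) 0; first by rewrite normr0.
  have Lx0' : `|L x| != 0 by rewrite normr_eq0.
  (* Rotating [x] by the unimodular [mu] makes [L (mu *: x)] equal to the real number [|L x|], hence
     to [w (mu *: x)], which is at most [|x|]. *)
  pose mu : R[i] := `|L x| / L x.
  have mu1 : `|mu| = 1 by rewrite normrM normrV ?unitfE// normr_id mulfV.
  have : L (mu *: x) = `|L x| by rewrite linearZ; exact: divfK.
  move=> /(congr1 (@complex.Re R)) wmu.
  rewrite -[leLHS]RRe_real ?normr_real// -wmu.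
  by rewrite -[`|x|]mul1r -mu1 -normrZ -NE lecR; exact: wN.
exists L; split=> // c Cc.
have Rec : complex.Re (L c) = N c by rewrite /= wC.
(* The modulus of [L c] is at most [N c], which is already its real part; this forces the imaginary
   part to vanish. *)
have := Lle c; rewrite -NE normc_def Rec lecR => h.
have Nc0 : 0 <= N c by rewrite -ler0c NE.
have Im0 : complex.Im (L c) ^+ 2 <= 0.
  rewrite -(gerDl (N c ^+ 2)) -ler_sqrt; last exact: sqr_ge0.
  by rewrite [leRHS]sqrtr_sqr ger0_norm.
have {}Im0 : complex.Im (L c) = 0.
  by apply/eqP; rewrite -sqrf_eq0 eq_le Im0 sqr_ge0.
by rewrite [LHS]complexE Rec Im0 mulr0 addr0.
Qed.

(** * Closures, subspaces, unit functionals and faces in normed spaces *)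

Section NormedModule.
Context {K : numFieldType}.
Implicit Types X Y : normedModType K.

Lemma closure_normP X (A : set X) (x : X) :
  closure A x <-> forall e, 0 < e -> exists2 a, A a & `|x - a| < e.
Proof.
split=> [clA e e0|clA B /nbhs_ballP[e /= e0 eB]].
  have [a [Aa]] := clA _ (nbhsx_ballx x e e0).
  by rewrite -ball_normE; exists a.
have [a Aa xa] := clA e e0; exists a; split=> //; apply: eB.
by rewrite -ball_normE.
Qed.

Lemma dense_normP X (A : set X) :
  dense A -> forall x e, 0 < e -> exists2 a, A a & `|x - a| < e.
Proof.
move=> dA x e e0.
have [||a [xa Aa]] := dA (ball x e); first by exists x; exact: ballxx.
  exact: ball_open.
by exists a => //; move: xa; rewrite -ball_normE.
Qed.

Lemma normr_small_eq0 X (x : X) : (forall e, 0 < e -> `|x| <= e) -> x = 0.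
Proof.
move=> h; apply/eqP; rewrite -normr_le0; apply/ler_addgt0Pr => e e0.
by rewrite add0r h.
Qed.

Lemma subspaceP X (A : set X) : is_subspace A <->
  A 0 /\ forall (k : K) x y, A x -> A y -> A (k *: x + y).
Proof.
split=> -[A0 AD]; split.
- by move: A0; rewrite inE.
- by move=> k x y Ax Ay; have := AD k x y; rewrite !inE; apply.
- by rewrite inE.
- by move=> k x y; rewrite !inE; exact: AD.
Qed.

Lemma subspaceN X (A : set X) x : is_subspace A -> A x -> A (- x).
Proof.
move=> /subspaceP[A0 AD] Ax.
by have := AD (-1) _ _ Ax A0; rewrite scaleN1r addr0.
Qed.

Lemma subspaceD X (A : set X) x y : is_subspace A -> A x -> A y -> A (x + y).
Proof.
by move=> /subspaceP[_ AD] Ax Ay; have := AD 1 _ _ Ax Ay; rewrite scale1r.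
Qed.

Lemma subspaceZ X (A : set X) k x : is_subspace A -> A x -> A (k *: x).
Proof.
by move=> /subspaceP[A0 AD] Ax; have := AD k _ _ Ax A0; rewrite addr0.
Qed.

Lemma subspace_smallest X (A : set X) : is_subspace (smallest is_subspace A).
Proof.
apply/subspaceP; split=> [B [/subspaceP[]]//|k x y Ax Ay B BA].
have /subspaceP[_ BD] := BA.1.
by apply: BD; [exact: Ax|exact: Ay].
Qed.

(* The bound [|k| + 1] in place of [|k|] spares the case [k = 0]. *)
Lemma subspace_closure X (A : set X) : is_subspace A -> is_subspace (closure A).
Proof.
move=> /subspaceP[A0 AD]; apply/subspaceP; split; first exact: subset_closure.
move=> k x y /closure_normP cx /closure_normP cy; apply/closure_normP => e e0.
have e2 : 0 < e / 2 by rewrite divr_gt0.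
have k1 : 0 < `|k| + 1 by rewrite ltr_wpDl.
have [a Aa xa] := cx (e / 2 / (`|k| + 1)) (divr_gt0 e2 k1).
have [b Ab yb] := cy (e / 2) e2.
exists (k *: a + b); first exact: AD.
rewrite opprD addrACA -scalerBr [e]splitr.
apply: (le_lt_trans (ler_normD _ _)); rewrite ler_ltD// normrZ.
apply: (@le_trans _ _ ((`|k| + 1) * `|x - a|)).
  by rewrite ler_wpM2r// lerDl.
by rewrite mulrC -ler_pdivlMr// ltW.
Qed.

Lemma subspace_closed_span X (A : set X) : is_subspace (closed_span A).
Proof. exact/subspace_closure/subspace_smallest. Qed.

Lemma sub_closed_span X (A : set X) : A `<=` closed_span A.
Proof. by move=> x Ax; apply: subset_closure; apply: sub_gen_smallest. Qed.

Lemma closed_span_sub X (A B : set X) :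
  is_subspace B -> closure B `<=` B -> A `<=` B -> closed_span A `<=` B.
Proof.
move=> Bs Bcl AB; apply: (subset_trans _ Bcl); apply: closureS.
exact: smallest_sub.
Qed.

Lemma contraction_continuous X (u : {linear X -> K^o}) :
  (forall x, `|u x| <= `|x|) -> continuous u.
Proof.
move=> u1 x; apply/cvgrPdist_lt => e e0; near=> y.
rewrite -linearB; apply: le_lt_trans (u1 _) _.
near: y; apply/nbhs_ballP; exists e => //= y.
by rewrite -ball_normE.
Unshelve. all: by end_near. Qed.

Lemma closed_ker X (u : {linear X -> K^o}) :
  (forall x, `|u x| <= `|x|) -> closure [set x | u x = 0] `<=` [set x | u x = 0].
Proof.
move=> u1 x /closure_normP cx; apply: (@normr_small_eq0 K^o) => e e0.
have [a /= ua xa] := cx e e0.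
by rewrite -[u x]subr0 -ua -linearB (le_trans (u1 _))// ltW.
Qed.

Lemma subspace_ker X Y (u : {linear X -> Y}) : is_subspace [set x | u x = 0].
Proof.
apply/subspaceP; split=> [|k x y /= ux uy]; first exact: linear0.
by rewrite linearP ux uy scaler0 addr0.
Qed.

(** [supremum] falls back on the default 0 when no supremum exists; as 1 differs from 0, a dual norm
    equal to 1 is a genuine supremum. *)
Lemma unit_functionalP X (u : {linear X -> K^o}) :
  unit_functional u <->
  continuous u /\ supremums [set `|u f| | f in [set f | `|f| <= 1]] 1.
Proof.
have A0 : [set `|u f| | f in [set f | `|f| <= 1]] != set0.
  by apply/set0P; exists `|u 0|, 0 => //=; rewrite normr0.
rewrite /unit_functional /dual_norm /supremum (negbTE A0).
split=> -[uc u1]; split=> //.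
  move: u1; case: xgetP => [x -> + x1|_ /eqP]; first by rewrite x1.
  by rewrite eq_sym oner_eq0.
apply: xget_unique => // y [y1 y2].
by apply/eqP; rewrite eq_le y2 ?u1.2//; case: u1.
Qed.

Lemma unit_functional_le X (u : {linear X -> K^o}) :
  unit_functional u -> forall x, `|u x| <= `|x|.
Proof.
move=> /unit_functionalP[_ [u1 _]] x.
have [->|x0] := eqVneq x 0; first by rewrite linear0 !normr0.
have nx0 : 0 < `|x| by rewrite normr_gt0.
have : `|u (`|x|^-1 *: x)| <= 1.
  apply: u1; exists (`|x|^-1 *: x) => //=.
  by rewrite normrZ normfV normr_id mulVf// normr_eq0.
by rewrite linearZ normrM normfV normr_id ler_pdivrMl// mulr1.
Qed.

Lemma face_unit_functional X (u : {linear X -> K^o}) :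
  (forall x, `|u x| <= `|x|) -> face u !=set0 -> unit_functional u.
Proof.
move=> u1 [f [f1 uf]]; apply/unit_functionalP.
split; first exact: contraction_continuous.
split=> [_ [g /= g1 <-]|y]; first exact: le_trans (u1 g) g1.
by apply; exists f => //; rewrite uf normr1.
Qed.

Lemma ortho_compl0 X (F : set X) : ortho_compl F 0.
Proof. by move=> g _; split; rewrite ?add0r ?sub0r ?normrN normr0 add0r. Qed.

Lemma ortho_complN X (F : set X) x : ortho_compl F x -> ortho_compl F (- x).
Proof.
move=> Fx g /Fx[xg xg']; split; last by rewrite -opprD !normrN.
by rewrite addrC -normrN opprB distrC [RHS]addrC normrN addrC -xg' distrC.
Qed.

Lemma is_symmetry_fix X (F : set X) (S : {linear X -> X}) x :
  is_symmetry F S -> closed_span F x -> S x = x.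
Proof.
move=> [_ _ _ [_ /subspaceP[G0 _] _ fixE]] Fx.
suff : fixed_points S x by [].
by rewrite fixE; exists x => //; exists 0 => //; rewrite addr0.
Qed.

End NormedModule.

(** * Functionals separating a face from its orthogonal complement *)

Section Separation.
Context {K : numFieldType} {X : normedModType K}.

(** If [s <= t], then [t (x + y) = (s x + t y) + (t - s) x], and the triangle inequality bounds the
    norm of [s x + t y] from below. *)
Lemma norm_add_scale (x y : X) (s t : K) : 0 <= s -> 0 <= t ->
  `|x + y| = `|x| + `|y| -> `|s *: x + t *: y| = s * `|x| + t * `|y|.
Proof.
have half (x' y' : X) (s' t' : K) : 0 <= s' -> s' <= t' ->
    `|x' + y'| = `|x'| + `|y'| ->
    s' * `|x'| + t' * `|y'| <= `|s' *: x' + t' *: y'|.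
  move=> s0 st xy; have t0 := le_trans s0 st.
  have := ler_normD (s' *: x' + t' *: y') ((t' - s') *: x').
  rewrite addrAC -scalerDl addrCA subrr addr0 -scalerDr !normrZ.
  rewrite (ger0_norm t0) ger0_norm ?subr_ge0// xy => h.
  rewrite -(lerD2r ((t' - s') * `|x'|)); apply: (le_trans _ h).
  rewrite le_eqVlt; apply/orP; left; apply/eqP; ring.
move=> s0 t0 xy; apply/eqP; rewrite eq_le; apply/andP; split.
  by apply: (le_trans (ler_normD _ _)); rewrite !normrZ !ger0_norm.
have /orP[st|ts] := ger_leVge s0 t0; first exact: half.
by rewrite addrC [in leRHS]addrC; apply: half => //; rewrite addrC xy addrC.
Qed.

Hypothesis HB : norms_cones X.
Variable u : {linear X -> K^o}.
Hypothesis u1 : forall x, `|u x| <= `|x|.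

(** Hahn-Banach for the cone [C] spanned by the face and [b]. The norm is additive on the vectors
    [a] with [u a = |a|], since [u] is a contraction, and on such an [a] together with [b], since
    [a / |a|] lies in the face and is orthogonal to [b]. *)
Lemma norming_functional (b : X) : ortho_compl (face u) b ->
  exists w : {linear X -> K^o}, [/\ forall x, `|w x| <= `|x|,
    forall f, face u f -> w f = 1 & w b = `|b|].
Proof.
move=> bF.
pose C := [set x | exists a t, [/\ 0 <= t, u a = `|a| & x = a + t *: b]].
have CN a t : 0 <= t -> u a = `|a| -> `|a + t *: b| = `|a| + t * `|b|.
  move=> t0 ua; have [->|a0] := eqVneq a 0.
    by rewrite normr0 !add0r normrZ ger0_norm.
  have na0 : `|a| != 0 by rewrite normr_eq0.
  have [|fb _] := bF (`|a|^-1 *: a).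
    split; first by rewrite normrZ normfV normr_id mulVf.
    by rewrite linearZ /= ua; exact: mulVf.
  rewrite addrC in fb; rewrite [RHS]addrC in fb.
  have := norm_add_scale (normr_ge0 a) t0 fb.
  rewrite scalerA mulfV// scale1r => ->.
  by rewrite normrZ normfV normr_id mulVf// mulr1.
have CA a a' : u a = `|a| -> u a' = `|a'| -> `|a + a'| = `|a| + `|a'|.
  move=> ua ua'; apply/eqP; rewrite eq_le ler_normD /= -ua -ua' -linearD.
  apply: le_trans (u1 (a + a')).
  by rewrite linearD ua ua' ger0_norm// addr_ge0.
have [|||| w [w1 wC]] := HB (C := C).
- by exists 0, 0; split=> //; rewrite ?linear0 ?normr0// scale0r addr0.
- move=> _ _ [a [t [t0 ua ->]]] [a' [t' [t'0 ua' ->]]].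
  exists (a + a'), (t + t'); split; first exact: addr_ge0.
    by rewrite linearD CA// ua ua'.
  by rewrite scalerDl addrACA.
- move=> r _ r0 [a [t [t0 ua ->]]]; exists (r *: a), (r * t).
  split; first exact: mulr_ge0.
    by rewrite linearZ /= ua normrZ ger0_norm.
  by rewrite scalerDr scalerA.
- move=> _ _ [a [t [t0 ua ->]]] [a' [t' [t'0 ua' ->]]].
  rewrite addrACA -scalerDl !CN ?addr_ge0//; first by rewrite CA// mulrDl addrACA.
  by rewrite linearD CA// ua ua'.
exists w; split=> //.
- move=> f [f1 uf].
  have nf : `|f| = 1.
    by apply/eqP; rewrite eq_le f1 /=; have := u1 f; rewrite uf normr1.
  rewrite wC ?nf//; exists f, 0; split=> //; first by rewrite uf nf.
  by rewrite scale0r addr0.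
- rewrite wC//; exists 0, 1; split=> //; first by rewrite linear0 normr0.
  by rewrite scale1r add0r.
Qed.

(* Half the difference of norming functionals of [face u] together with [b] and
   of [face u] together with [- b]. *)
Lemma ortho_functional (b : X) : ortho_compl (face u) b ->
  exists v : {linear X -> K^o}, [/\ forall x, `|v x| <= `|x|,
    forall f, face u f -> v f = 0, v b = `|b|
    & forall z, `|z| <= 1 -> v z = 1 -> ortho_compl (face u) z].
Proof.
move=> bF; have [w [w1 wF wb]] := norming_functional bF.
have [w' [w'1 w'F w'b]] := norming_functional (ortho_complN bF).
have {}w'b : w' b = - `|b| by rewrite -[b in LHS]opprK linearN /= w'b normrN.
exists (2^-1 \*: (w \- w')) => /=; split.
- move=> x; rewrite normrZ ger0_norm ?invr_ge0// ler_pdivrMl//.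
  apply: (le_trans (ler_normB _ _)).
  by rewrite mulr_natl mulr2n lerD.
- by move=> f Ff; rewrite wF// w'F// subrr scaler0.
- by rewrite wb w'b opprK -mulr2n -[X in _ *: X]mulr_natl; exact: mulKf.
- move=> z z1 vz f Ff; have [f1 uf] := Ff.
  have wz : w z - w' z = 2.
    have := congr1 ( *%R 2) vz; rewrite mulr1 => <-.
    by apply/esym/mulVKf; rewrite pnatr_eq0.
  (* As [z] and [f] lie in the unit ball, it suffices that [z + f] and [z - f] have norm at least 2.
     From [w z - w' z = 2] follow [w (z + f) = 3 + w' z] and [w' (f - z) = 3 - w z], both of modulus
     at least [3 - 1]. *)
  have ge2 (y : X) : 2 <= `|y| -> `|y| <= `|z| + `|f| -> `|y| = `|z| + `|f|.
    move=> y2 yzf; apply/eqP; rewrite eq_le yzf (le_trans _ y2)//.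
    by rewrite (le_trans (lerD z1 f1)).
  have wzE : w z = 2 + w' z :> K by rewrite -wz subrK.
  have le32 (t : K) : t <= 1 -> 2 <= 3 - t.
    by move=> t1; rewrite lerBrDr -[3]/(2 + 1)%:R natrD lerD2l.
  split; apply: ge2; rewrite ?ler_normD ?ler_normB//.
  + apply: (le_trans _ (w1 _)).
    have -> : w (z + f) = 3 + w' z :> K.
      transitivity (w z + w f : K); first exact: linearD.
      by rewrite (wF f Ff) wzE addrAC -[3]/(2 + 1)%:R natrD.
    have := lerB_dist (3 : K) (- w' z); rewrite opprK normrN normr_nat.
    by apply: le_trans; rewrite le32// (le_trans (w'1 z)).
  + rewrite distrC; apply: (le_trans _ (w'1 _)).
    have -> : w' (f - z) = 3 - w z :> K.
      transitivity (w' f - w' z : K); first exact: linearB.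
      by rewrite (w'F f Ff) wzE opprD addrA -[3]/(1 + 2)%:R natrD addrK.
    have := lerB_dist (3 : K) (w z); rewrite normr_nat.
    by apply: le_trans; rewrite le32// (le_trans (w1 z)).
Qed.

(** The functional of [ortho_functional] kills the closed span of the face and norms [b], so its
    value at [a + b] is [|b|]. *)
Lemma ortho_norm_le (a b : X) :
  closed_span (face u) a -> ortho_compl (face u) b -> `|b| <= `|a + b|.
Proof.
move=> aF /ortho_functional[v [v1 vF vb _]].
have va : v a = 0.
  move: a aF; apply: closed_span_sub; [exact: subspace_ker|exact: closed_ker|].
  exact: vF.
have <- : `|v (a + b)| = `|b| by rewrite linearD va vb add0r normr_id.
exact: v1.
Qed.

End Separation.

(** * Uniqueness of the symmetry of a face *)

Section Uniqueness.
Context {K : numFieldType} {X : normedModType K}.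
Hypothesis archK : forall x y : K, 0 <= x -> (forall n, x *+ n <= y) -> x = 0.

(* If [S x = - x] then [p = x + T x] is fixed by [S] and [T], and the isometry
   [S T] maps [x + n p] to [x + (n + 1) p]. *)
Lemma involution_unique (S T : {linear X -> X}) :
  (forall x, `|S x| = `|x|) -> (forall x, `|T x| = `|x|) ->
  (forall x, S (S x) = x) -> (forall x, T (T x) = x) ->
  fixed_points S = fixed_points T -> S =1 T.
Proof.
move=> S1 T1 SS TT fixE.
have fixST x : S x = x <-> T x = x.
  by rewrite -[S x = x]/(fixed_points S x) fixE.
have anti x : S x = - x -> T x = - x.
  move=> Sx; set p := x + T x.
  have Tp : T p = p by rewrite linearD TT addrC.
  have Sp : S p = p by apply/fixST.
  have STx : S (T x) = x + p.
    have -> : T x = p - x by rewrite /p addrAC subrr add0r.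
    by rewrite linearB Sp Sx opprK addrC.
  have xnp n : `|x + p *+ n| = `|x|.
    elim: n => [|n IHn]; first by rewrite addr0.
    rewrite -IHn -[RHS]T1 -[RHS]S1 !linearD !linearMn /= Tp Sp STx.
    by rewrite mulrS addrA.
  have p0 : `|p| = 0.
    apply: (archK (y := `|x| + `|x|)) => // n.
    rewrite -normrMn -[p *+ n](addKr x) addrC.
    by apply: le_trans (ler_normB _ _) _; rewrite xnp.
  by apply/eqP; rewrite -subr_eq0 opprK addrC -normr_eq0 -/p p0.
(* Every vector splits into a part fixed by [S] and a part negated by [S]; [T] agrees with [S] on
   each. *)
move=> x; pose y := 2^-1 *: (x + S x); pose z := 2^-1 *: (x - S x).
have xE : x = y + z.
  rewrite -scalerDr addrACA subrr addr0 -mulr2n -[x *+ 2]scaler_nat scalerA.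
  by rewrite mulVf// scale1r.
have Sy : S y = y by rewrite linearZ linearD SS addrC.
have Sz : S z = - z by rewrite linearZ linearB SS -scalerN opprB.
have Ty : T y = y by apply/fixST.
by rewrite xE !linearD Sy Ty Sz anti.
Qed.

Lemma symmetry_unique (F : set X) (S T : {linear X -> X}) :
  is_symmetry F S -> is_symmetry F T -> S =1 T.
Proof.
move=> [_ S1 SS [_ _ _ fixS]] [_ T1 TT [_ _ _ fixT]].
by apply: involution_unique => //; rewrite fixS fixT.
Qed.

End Uniqueness.

(** * Limits in complete spaces and extension of isometries *)

Lemma complete_limit (K : numFieldType) (Y : completeNormedModType K)
    (G : K -> set Y) :
  (forall e, 0 < e -> G e !=set0) ->
  (forall d e, 0 < d -> d <= e -> G d `<=` G e) ->
  (forall e x y, 0 < e -> G e x -> G e y -> `|x - y| < e + e) ->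
  exists y, forall e, 0 < e -> exists2 x, G e x & `|y - x| < e.
Proof.
move=> G0 Gmono Gdiam.
(* [G e] collects the candidates at precision [e]; the filter that these sets generate is Cauchy,
   which spares choosing a sequence. *)
pose F := filter_from [set e : K | 0 < e] G.
(* The order of [K] may be partial, but nonnegative elements are comparable. *)
have min_pos (d e : K) : 0 < d -> 0 < e ->
    exists m, [/\ 0 < m, m <= d & m <= e].
  move=> d0 e0; have /orP[de|ed] := ger_leVge (ltW d0) (ltW e0).
    by exists d.
  by exists e.
have FF : ProperFilter F.
  apply: filter_from_proper; last exact: G0.
  apply: filter_from_filter; first by exists 1 => /=.
  move=> d e /= d0 e0; have [m [m0 md me]] := min_pos _ _ d0 e0.
  by exists m => // x Gx; split; [exact: Gmono md _ Gx|exact: Gmono me _ Gx].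
have /cauchy_cvg/cvg_ex[y Fy] : cauchy F.
  apply: cauchy_exP => e /= e0; have e2 : 0 < e / 2 by rewrite divr_gt0.
  have [x Gx] := G0 _ e2; exists x; exists (e / 2) => //= z Gz.
  by rewrite -ball_normE /= [e]splitr; exact: Gdiam.
exists y => e e0.
have [d /= d0 Gd] := Fy _ (nbhsx_ballx y e e0).
have [m [m0 md me]] := min_pos _ _ d0 e0.
have [x Gx] := G0 _ m0; exists x; first exact: Gmono me _ Gx.
by have := Gd x (Gmono _ _ m0 md _ Gx); rewrite -ball_normE.
Qed.

(** The value [U x] is chosen so that [|U x - T z| <= |x - iota z|] for every [z]; linearity,
    isometry and agreement with [T] are all read off from this bound. *)
Lemma isometric_extension (K : numFieldType) (Z X : normedModType K)
    (Y : completeNormedModType K) (iota : {linear Z -> X}) (T : {linear Z -> Y}) :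
  (forall z, `|iota z| = `|z|) -> dense (range iota) ->
  (forall z, `|T z| = `|z|) ->
  exists U : {linear X -> Y},
    (forall x, `|U x| = `|x|) /\ forall z, U (iota z) = T z.
Proof.
move=> iotaN iotaD TN.
have approx x e : 0 < e -> exists z, `|x - iota z| < e.
  by move=> e0; have [_ [z _ <-] xz] := dense_normP iotaD x e0; exists z.
have /choice[U UP] : forall x, exists y, forall z, `|y - T z| <= `|x - iota z|.
  move=> x.
  have [||e _ _ e0 [z1 xz1 <-] [z2 xz2 <-]|y yP] :=
      @complete_limit K Y (fun e => [set T z | z in [set z | `|x - iota z| < e]]).
  - by move=> e /approx-/(_ x)[z xz]; exists (T z), z.
  - by move=> d e d0 de _ [z xz <-]; exists z => //=; exact: lt_le_trans de.
  - rewrite -linearB TN -iotaN linearB -(subrKA x).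
    by rewrite (le_lt_trans (ler_normD _ _))// ltrD// distrC.
  exists y => z; apply/ler_addgt0Pr => e e0.
  have e2 : 0 < e / 2 by rewrite divr_gt0.
  have [_ [z' /= xz' <-] yz'] := yP _ e2.
  have Tz'z : `|T z' - T z| <= `|x - iota z| + e / 2.
    rewrite -linearB TN -iotaN linearB -(subrKA x).
    by apply: (le_trans (ler_normD _ _)); rewrite [leLHS]addrC lerD2l distrC ltW.
  rewrite -(subrKA (T z')); apply: (le_trans (ler_normD _ _)).
  by rewrite [e in leRHS]splitr [leRHS]addrCA lerD// ltW.
have Ulin : linear U.
  move=> k x y; apply/eqP; rewrite -subr_eq0; apply/eqP.
  apply: normr_small_eq0 => e e0.
  (* The errors on [k *: x] and on [y] each occur twice, before and after applying [U]: four terms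
     of at most [e / 4]. *)
  have e4 : 0 < e / 2 / 2 by rewrite !divr_gt0.
  have k1 : 0 < `|k| + 1 by rewrite ltr_wpDl.
  have [z xz] := approx x _ (divr_gt0 e4 k1); have [z' yz'] := approx y _ e4.
  have kxz : `|k| * `|x - iota z| <= e / 2 / 2.
    apply: (@le_trans _ _ ((`|k| + 1) * `|x - iota z|)).
      by rewrite ler_wpM2r// lerDl.
    by rewrite mulrC -ler_pdivlMr// ltW.
  rewrite -(subrKA (T (k *: z + z'))) [e]splitr.
  apply: (le_trans (ler_normD _ _)); apply: lerD.
    apply: le_trans (UP _ _) _; rewrite linearP opprD addrACA -scalerBr.
    apply: (le_trans (ler_normD _ _)); rewrite normrZ [e / 2]splitr.
    by rewrite lerD// ltW.
  rewrite linearP opprD addrACA -scalerBr.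
  apply: (le_trans (ler_normD _ _)); rewrite normrZ [e / 2]splitr lerD//.
    by apply: le_trans kxz; rewrite ler_wpM2l// distrC.
  by rewrite distrC (le_trans (UP _ _))// ltW.
pose L : {linear X -> Y} := HB.pack U (GRing.isLinear.Build _ _ _ _ U Ulin).
have UE z : U (iota z) = T z.
  apply/eqP; rewrite -subr_eq0 -normr_le0; apply: le_trans (UP _ z) _.
  by rewrite subrr normr0.
have Ule x : `|U x| <= `|x|.
  by have := UP x 0; rewrite !linear0 !addr0.
have Uge x : `|x| <= `|U x|.
  apply/ler_addgt0Pr => e e0; have e2 : 0 < e / 2 by rewrite divr_gt0.
  have [z xz] := approx x _ e2.
  rewrite -[x in leLHS](subrK (iota z)).
  apply: (le_trans (ler_normD _ _)); rewrite iotaN -TN -[T z](subrK (U x)).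
  rewrite [e]splitr.
  apply: (@le_trans _ _ (e / 2 + (`|T z - U x| + `|U x|))).
    by rewrite lerD ?ler_normD// ltW.
  rewrite [leRHS]addrC -addrA lerD2l lerD2r distrC.
  by apply: le_trans (UP _ _) _; rewrite ltW.
by exists L; split=> // x; apply/le_anti; rewrite Ule Uge.
Qed.

(** * Transfer of functionals, faces and symmetries to the completion *)

Section FacialCompletion.
Context {K : numFieldType} {Z : normedModType K} {Zt : completeNormedModType K}.
Variable iota : {linear Z -> Zt}.
Hypothesis iotaN : forall z, `|iota z| = `|z|.
Hypothesis iotaD : dense (range iota).

Let restrict (ut : {linear Zt -> K^o}) : {linear Z -> K^o} := ut \o iota.

Lemma range_approx x e : 0 < e -> exists z, `|x - iota z| < e.
Proof.
by move=> e0; have [_ [z _ <-] xz] := dense_normP iotaD x e0; exists z.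
Qed.

Lemma restrict_le (ut : {linear Zt -> K^o}) :
  (forall x, `|ut x| <= `|x|) -> forall z, `|restrict ut z| <= `|z|.
Proof. by move=> ut1 z; rewrite -iotaN; exact: ut1. Qed.

Lemma restrict_unit_functional (ut : {linear Zt -> K^o}) :
  unit_functional ut -> unit_functional (restrict ut).
Proof.
move=> utu; have ut1 := unit_functional_le utu.
have u1 := restrict_le ut1.
apply/unit_functionalP; split; first exact: contraction_continuous.
split=> [_ [z /= z1 <-]|y yub]; first exact: le_trans (u1 z) z1.
have y0 : 0 <= y.
  by apply: le_trans (yub `|restrict ut 0| _) => //; exists 0 => //=; rewrite normr0.
have uy z : `|ut (iota z)| <= y * `|z|.
  have [->|z0] := eqVneq z 0; first by rewrite !linear0 !normr0 mulr0.
  have nz0 : 0 < `|z| by rewrite normr_gt0.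
  have : `|restrict ut (`|z|^-1 *: z)| <= y.
    apply: yub; exists (`|z|^-1 *: z) => //=.
    by rewrite normrZ normfV normr_id mulVf// gt_eqF.
  by rewrite linearZ normrM normfV normr_id ler_pdivrMl// mulrC.
have /unit_functionalP[_ [_]] := utu; apply => _ [g /= g1 <-].
apply/ler_addgt0Pr => e e0.
have y1 : 0 < y + 1 by rewrite ltr_wpDl.
(* The approximant may leave the unit ball by [e / (y + 1)], whence the homogeneous bound [uy]; the
   total error [e / (y + 1) + y * (e / (y + 1))] is exactly [e]. *)
have [z gz] := range_approx g (divr_gt0 e0 y1).
have zle : `|z| <= 1 + e / (y + 1).
  rewrite -iotaN -[iota z](subrK g) addrC; apply: (le_trans (ler_normD _ _)).
  by rewrite lerD// distrC ltW.
rewrite -[g](subrK (iota z)) linearD; apply: (le_trans (ler_normD _ _)).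
apply: (@le_trans _ _ (e / (y + 1) + y * (1 + e / (y + 1)))).
  apply: lerD; first by rewrite (le_trans (ut1 _))// ltW.
  by apply: le_trans (uy z) _; rewrite ler_wpM2l.
have -> : e / (y + 1) + y * (1 + e / (y + 1)) = y + e / (y + 1) * (y + 1) by ring.
by rewrite divfK// gt_eqF.
Qed.

Lemma restrict_norm_extension (ut : {linear Zt -> K^o}) :
  unit_functional ut -> norm_extension iota (restrict ut) ut.
Proof.
move=> utu; split=> //; first by case: utu.
by rewrite utu.2 (restrict_unit_functional utu).2.
Qed.

Lemma face_restrict (ut : {linear Zt -> K^o}) z :
  face (restrict ut) z <-> face ut (iota z).
Proof. by rewrite /face /= iotaN. Qed.

Section Symmetry.
Hypotheses (HBZ : norms_cones Z) (HBZt : norms_cones Zt).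
Hypothesis density : face_density iota.
Variable ut : {linear Zt -> K^o}.
Hypotheses (utu : unit_functional ut) (Ft0 : face ut !=set0).
Let F := face (restrict ut).
Variable S : {linear Z -> Z}.
Hypothesis SF : is_symmetry F S.

Let closureF : closure (iota @` F) = face ut.
Proof.
exact: (density (restrict_unit_functional utu) (restrict_norm_extension utu)
  Ft0).2.
Qed.

Let orthoF_subspace : is_subspace (ortho_compl F).
Proof. by case: SF => _ _ _ []. Qed.

(** For nonzero [b], face density makes [b / |b|] a limit of points of [Z] exposed by [v], which are
    orthogonal to [F]. The converse inclusion is continuity of the norm, since [face ut] is itself
    the closure of the image of [F]. *)
Lemma ortho_compl_completion :
  ortho_compl (face ut) = closure (iota @` ortho_compl F).
Proof.
apply/seteqP; split=> [b bF|b /closure_normP cb g].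
  have [b0|b0] := eqVneq b 0.
    apply: subset_closure; exists 0; first exact: ortho_compl0.
    by rewrite linear0 b0.
  have nb0 : 0 < `|b| by rewrite normr_gt0.
  have [v [v1 _ vb vF]] := ortho_functional HBZt (unit_functional_le utu) bF.
  have vface : face v (`|b|^-1 *: b).
    split; first by rewrite normrZ normfV normr_id mulVf// gt_eqF.
    by rewrite linearZ /= vb; apply: mulVf; rewrite gt_eqF.
  have v0 : face v !=set0 by exists (`|b|^-1 *: b).
  have vu := face_unit_functional v1 v0.
  have [_ vcl] := density (restrict_unit_functional vu)
    (restrict_norm_extension vu) v0.
  move: vface; rewrite -vcl => /closure_normP cb; apply/closure_normP => e e0.
  have [_ [z [z1 vz] <-] bz] := cb _ (divr_gt0 e0 nb0).
  (* Rescaling by [|b|] stays in [ortho_compl F], a subspace by the decomposition belonging to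
     [S]. *)
  exists (iota (`|b| *: z)).
    exists (`|b| *: z) => //; apply: (subspaceZ (A := ortho_compl F)) => // f Ff.
    have zF : ortho_compl (face ut) (iota z) by apply: vF; rewrite ?iotaN.
    have [] := zF (iota f); first exact/face_restrict.
    by rewrite -linearD -linearB !iotaN.
  have -> : b - iota (`|b| *: z) = `|b| *: (`|b|^-1 *: b - iota z).
    by rewrite scalerBr scalerA mulfV ?gt_eqF// scale1r linearZ.
  by rewrite normrZ normr_id mulrC -ltr_pdivlMr.
rewrite -closureF => /closure_normP cg.
(* To be used with [y = b + g] and [y = b - g], so that both halves of orthogonality share the limit
   argument. *)
have half (y : Zt) : `|y| <= `|b| + `|g| ->
    (forall e, 0 < e -> exists c h, [/\ ortho_compl F c, F h,
       `|b - iota c| < e, `|g - iota h| < e & `|c| + `|h| <= `|y| + (e + e)]) ->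
    `|y| = `|b| + `|g|.
  move=> ybg yap; apply/eqP; rewrite eq_le ybg /=; apply/ler_addgt0Pr => e e0.
  have e4 : 0 < e / 2 / 2 by rewrite !divr_gt0.
  have [c [h [_ _ bc gh chy]]] := yap _ e4.
  have bce : `|b| <= `|c| + e / 2 / 2.
    rewrite -iotaN -[b in leLHS](subrK (iota c)) addrC.
    by apply: (le_trans (ler_normD _ _)); rewrite lerD2l ltW.
  have ghe : `|g| <= `|h| + e / 2 / 2.
    rewrite -iotaN -[g in leLHS](subrK (iota h)) addrC.
    by apply: (le_trans (ler_normD _ _)); rewrite lerD2l ltW.
  apply: (le_trans (lerD bce ghe)); rewrite addrACA -splitr.
  apply: (@le_trans _ _ (`|y| + (e / 2 / 2 + e / 2 / 2) + e / 2)).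
    by rewrite lerD2r.
  by rewrite -splitr -addrA -splitr.
have ap e : 0 < e -> exists c h, [/\ ortho_compl F c, F h,
    `|b - iota c| < e & `|g - iota h| < e].
  move=> e0; have [_ [c cF <-] bc] := cb _ e0.
  by have [_ [h hF <-] gh] := cg _ e0; exists c, h.
split; apply: half; rewrite ?ler_normD ?ler_normB// => e e0.
- have [c [h [cF hF bc gh]]] := ap _ e0; exists c, h; split=> //.
  have [<- _] := cF _ hF; rewrite -iotaN linearD.
  rewrite -[iota c](subrK b) -[iota h](subrK g) addrACA addrC.
  apply: (le_trans (ler_normD _ _)); rewrite lerD2l.
  by apply: (le_trans (ler_normD _ _)); rewrite lerD// distrC ltW.
- have [c [h [cF hF bc gh]]] := ap _ e0; exists c, h; split=> //.
  have [_ <-] := cF _ hF; rewrite -iotaN linearB.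
  rewrite -[iota c](subrK b) -[iota h](subrK g) opprD addrACA addrC.
  apply: (le_trans (ler_normD _ _)); rewrite lerD2l.
  by apply: (le_trans (ler_normB _ _)); rewrite lerD// distrC ltW.
Qed.

Lemma closed_span_completion a :
  closed_span F a -> closed_span (face ut) (iota a).
Proof.
move=> /closure_normP ca; apply/closure_normP => e e0.
have [s Fs as_] := ca e e0; exists (iota s); last by rewrite -linearB iotaN.
move: s Fs {as_}.
have : is_subspace [set s | smallest is_subspace (face ut) (iota s)].
  have /subspaceP[G0 GD] := subspace_smallest (face ut).
  apply/subspaceP; split=> [|k x y /= Gx Gy]; first by rewrite /= linear0.
  by rewrite linearP; exact: GD.
move=> /smallest_sub; apply => f Ff.
by apply: sub_gen_smallest; exact/face_restrict.
Qed.

(** [St] extends [S]. Density and closedness of its fixed points give one inclusion of the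
    decomposition; the other needs the components of approximating fixed points of [S] to
    converge. *)
Lemma symmetry_completion : exists St : {linear Zt -> Zt},
  is_symmetry (face ut) St /\ forall z, St (iota z) = iota (S z).
Proof.
have [_ SN SS [_ _ _ SfixE]] := SF.
have [|St [StN StE]] := isometric_extension (T := iota \o S) iotaN iotaD.
  by move=> z; rewrite /= iotaN SN.
rewrite /= in StE.
have StK x : St (St x) = x.
  apply/eqP; rewrite -subr_eq0; apply/eqP; apply: normr_small_eq0 => e e0.
  have e2 : 0 < e / 2 by rewrite divr_gt0.
  have [z xz] := range_approx x e2.
  rewrite -(subrKA (iota z)) [e]splitr; apply: (le_trans (ler_normD _ _)).
  rewrite lerD//; last by rewrite distrC ltW.
  by rewrite -{1}[z]SS -!StE -!linearB !StN ltW.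
have fixSt_subspace : is_subspace (fixed_points St).
  apply/subspaceP; split=> [|k x y]; first exact: linear0.
  by rewrite /fixed_points /= => Sx Sy; rewrite linearP Sx Sy.
have fixSt_closed : closure (fixed_points St) `<=` fixed_points St.
  move=> x /closure_normP cx; apply/eqP; rewrite -subr_eq0; apply/eqP.
  apply: normr_small_eq0 => e e0; have e2 : 0 < e / 2 by rewrite divr_gt0.
  have [y yS xy] := cx _ e2.
  rewrite -(subrKA y) -{1}yS -linearB [e]splitr.
  apply: (le_trans (ler_normD _ _)); rewrite StN [`|y - x|]distrC.
  by rewrite lerD// ltW.
have fixS_sub A : A `<=` fixed_points S -> iota @` A `<=` fixed_points St.
  by move=> AS _ [z Az <-]; rewrite /fixed_points /= StE /= (AS z Az).
have spanfix : closed_span (face ut) `<=` fixed_points St.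
  apply: closed_span_sub => //; rewrite -closureF.
  apply: (subset_trans _ fixSt_closed); apply: closureS; apply: fixS_sub => f Ff.
  by apply: is_symmetry_fix SF _; exact: sub_closed_span.
have orthofix : ortho_compl (face ut) `<=` fixed_points St.
  rewrite ortho_compl_completion; apply: (subset_trans _ fixSt_closed).
  apply: closureS; apply: fixS_sub => b bF.
  have /subspaceP[G0 _] := subspace_closed_span F.
  by rewrite SfixE; exists 0 => //; exists b => //; rewrite add0r.
have ortho_subspace : is_subspace (ortho_compl (face ut)).
  rewrite ortho_compl_completion; apply: subspace_closure.
  have /subspaceP[G0 GD] := orthoF_subspace.
  apply/subspaceP; split=> [|k _ _ [x xF <-] [y yF <-]].
    by exists 0 => //; rewrite linear0.
  by exists (k *: x + y); [exact: GD|rewrite linearP].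
exists St; split=> //; split=> //.
  by move=> y _; exists (St y).
split=> //; first exact: subspace_closed_span.
  apply/seteqP; split=> [y [yF yo]|_ ->].
    (* With [a = - y] and [b = y] the bound reads [|y| <= 0]. *)
    have := ortho_norm_le HBZt (unit_functional_le utu)
      (subspaceN (subspace_closed_span _) yF) yo.
    by rewrite addNr normr0 normr_le0 => /eqP.
  split; last exact: ortho_compl0.
  by have /subspaceP[] := subspace_closed_span (face ut).
apply/seteqP; split=> [f Sf|_ [a aF [b bF <-]]]; last first.
  by apply: subspaceD => //; [exact: spanfix|exact: orthofix].
(* [G e] holds the orthogonal components of the points [a + b] within [e] of [f]. By [ortho_norm_le]
   in [Z] they are as close to each other as the points themselves, so they converge to the
   orthogonal component [y] of [f], and the [a] converge to [f - y]. *)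
pose G e := [set iota b | b in [set b | ortho_compl F b /\
  exists2 a, closed_span F a & `|f - iota (a + b)| < e]].
have [e e0|d e d0 de _ [b [bF [a aF fab]] <-]|
      e _ _ e0 [b1 [b1F [a1 a1F h1]] <-] [b2 [b2F [a2 a2F h2]] <-]|y yP] :=
    @complete_limit K Zt G.
(* The average of [z] and [S z] is fixed by [S] and still within [e] of [f], because [St] is an
   isometry fixing [f]. *)
- have [z fz] := range_approx f e0.
  have : fixed_points S (2^-1 *: (z + S z)).
    by rewrite /fixed_points /= linearZ linearD SS addrC.
  rewrite SfixE => -[a aF [b bF abE]]; exists (iota b), b => //; split=> //.
  exists a => //; rewrite abE linearZ linearD.
  have -> : f = 2^-1 *: (f + f).
    by rewrite -mulr2n -[f *+ 2]scaler_nat scalerA mulVf// scale1r.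
  rewrite -scalerBr opprD addrACA normrZ ger0_norm ?invr_ge0// ltr_pdivrMl//.
  apply: (le_lt_trans (ler_normD _ _)); rewrite mulr_natl mulr2n ltrD//.
  by rewrite -[f in ltLHS]Sf -[iota (S z)]StE -linearB StN.
- exists b => //; split=> //; exists a => //; exact: lt_le_trans de.
- rewrite -linearB iotaN.
  apply: (@le_lt_trans _ _ `|(a1 - a2) + (b1 - b2)|).
    apply: (ortho_norm_le HBZ (restrict_le (unit_functional_le utu))).
      by apply: (subspaceD (subspace_closed_span F)) => //;
        exact: (subspaceN (subspace_closed_span F)).
    by apply: (subspaceD orthoF_subspace) => //; exact: (subspaceN orthoF_subspace).
  rewrite addrACA -opprD -iotaN linearB -(subrKA f).
  by apply: (le_lt_trans (ler_normD _ _)); rewrite ltrD// distrC.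
exists (f - y); last first.
  exists y; last exact: subrK.
  rewrite ortho_compl_completion; apply/closure_normP => e e0.
  by have [_ [b [bF _] <-] yb] := yP e e0; exists (iota b) => //; exists b.
have /closure_id-> : closed (closed_span (face ut)) by exact: closed_closure.
apply/closure_normP => e e0; have e2 : 0 < e / 2 by rewrite divr_gt0.
have [_ [b [bF [a aF fab]] <-] yb] := yP _ e2.
exists (iota a); first exact: closed_span_completion.
have -> : f - y - iota a = (f - iota (a + b)) - (y - iota b).
  by rewrite linearD opprD opprB (addrA f) subrKA addrAC.
by apply: (le_lt_trans (ler_normB _ _)); rewrite [e]splitr ltrD.
Qed.

End Symmetry.

End FacialCompletion.

(** * Strong facial symmetry of the completion over a general scalar field *)

Lemma SFS_completion (K : numFieldType) (Z : normedModType K)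
    (Zt : completeNormedModType K) (iota : {linear Z -> Zt}) :
  (forall x y : K, 0 <= x -> (forall n, x *+ n <= y) -> x = 0) ->
  norms_cones Z -> norms_cones Zt ->
  is_completion iota -> SFS Z -> face_density iota -> SFS Zt.
Proof.
move=> archK HBZ HBZt [iotaN iotaD] [ZWFS ZSFS] density.
have restrict_face (ut : {linear Zt -> K^o}) : unit_functional ut ->
    face ut !=set0 -> symmetric_face (face (ut \o iota : {linear Z -> K^o})).
  move=> utu ut0; apply: ZWFS; split.
    have uu := restrict_unit_functional iotaN iotaD utu.
    have ue := restrict_norm_extension iotaN iotaD utu.
    exact: (density _ _ uu ue ut0).1.
  by exists (ut \o iota : {linear Z -> K^o}) => //; exact: restrict_unit_functional.
split=> [Ft [Ft0 [ut utu FtE]]|ut vt utu [[ut0 _] _] vtu uvt St StF x].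
  split; first by split=> //; exists ut.
  rewrite {}FtE in Ft0 *.
  have [_ [S SF]] := restrict_face ut utu Ft0.
  have [St [StF _]] :=
    symmetry_completion iotaN iotaD HBZ HBZt density utu Ft0 SF.
  by exists St.
have [uface [S SF]] := restrict_face ut utu ut0.
have [St' [St'F St'E]] :=
  symmetry_completion iotaN iotaD HBZ HBZt density utu ut0 SF.
(* [St] is an arbitrary symmetry of the face; uniqueness replaces it by the one extending [S], about
   which the hypothesis on [Z] gives information. *)
rewrite (symmetry_unique archK StF St'F).
have vS z : vt (iota (S z)) = vt (iota z).
  apply: (ZSFS (ut \o iota : {linear Z -> K^o}) (vt \o iota : {linear Z -> K^o})
    _ _ _ _ S SF).
  - exact: restrict_unit_functional.
  - by split=> //; exists S.
  - exact: restrict_unit_functional.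
  - by move=> w /(face_restrict iotaN)/uvt/(face_restrict iotaN).
apply/eqP; rewrite -subr_eq0; apply/eqP; apply: (@normr_small_eq0 _ K^o) => e e0.
have e2 : 0 < e / 2 by rewrite divr_gt0.
have [z xz] := range_approx iotaD x e2.
have vt1 := unit_functional_le vtu.
have St'N : forall y, `|St' y| = `|y| by case: St'F.
rewrite -(subrKA (vt (iota z))) -{1}vS -St'E -!linearB [e]splitr.
apply: (le_trans (ler_normD _ _)); apply: lerD; apply: (le_trans (vt1 _)).
  by rewrite St'N ltW.
by rewrite distrC ltW.
Qed.

(** * The Archimedean property and the real and complex cases *)

Lemma archimedean_real (R : realType) (x y : R) :
  0 <= x -> (forall n, x *+ n <= y) -> x = 0.
Proof.
move=> x0 xy; apply/eqP; rewrite eq_le x0 andbT leNgt; apply/negP => {}x0.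
have y0 : 0 <= y by apply: le_trans (xy 0).
have := archi_boundP (divr_ge0 y0 (ltW x0)).
by rewrite ltr_pdivrMr// mulr_natl ltNge xy.
Qed.

Lemma archimedean_complex (R : realType) (x y : R[i]) :
  0 <= x -> (forall n, x *+ n <= y) -> x = 0.
Proof.
move=> x0 xy.
have xE : (complex.Re x)%:C%C = x by apply: RRe_real; exact: ger0_real.
(* The case [n = 0] gives [0 <= y], so [y] is real. *)
have yE : (complex.Re y)%:C%C = y by apply: RRe_real; apply: ger0_real (xy 0).
rewrite -xE; congr (_%:C)%C; apply: (@archimedean_real _ _ (complex.Re y)).
  by rewrite -ler0c xE.
by move=> n; rewrite -lecR rmorphMn /= xE yE.
Qed.

Theorem theorem3p1 (R : realType) (c : bool)
  (Z : normedModType (scalar_field R c))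
  (Zt : completeNormedModType (scalar_field R c))
  (iota : {linear Z -> Zt}) :
  is_completion iota -> SFS Z -> face_density iota -> SFS Zt.
Proof.
case: c Z Zt iota => Z Zt iota.
  apply: SFS_completion; first exact: archimedean_complex.
    exact: norms_cones_complex.
  exact: (@norms_cones_complex R Zt).
apply: SFS_completion; first exact: archimedean_real.
  exact: norms_cones_real.
exact: (@norms_cones_real R Zt).
Qed.
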